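(* For every real $\delta>0$ there is a $\delta$-share bandwidth allocation game which does not have a pure Nash equilibrium.
   Context: A bandwidth allocation game (BAG) is a tuple $(\mathcal{N},\mathcal{R},(b_r)_{r\in\mathcal{R}},(\mathcal{S}_i)_{i\in\mathcal{N}})$ with a set of players $\mathcal{N}=\{1,\dots,n\}$, a set of resources $\mathcal{R}=\{r_1,\dots,r_m\}$, a capacity $b_r>0$ for each resource $r$, and for each player $i$ a finite nonempty strategy space $\mathcal{S}_i\subset\mathbb{R}_{\ge 0}^m$. A strategy $s_i=(s_i(r_1),\dots,s_i(r_m))\in\mathcal{S}_i$ has demand $s_i(r)$ on resource $r$. A strategy profile is ${\sf s}=(s_1,\dots,s_n)\in\mathcal{S}=\mathcal{S}_1\times\dots\times\mathcal{S}_n$. The utility of player $i$ from resource $r$ is $u_{i,r}({\sf s})=\min\left(s_i(r),\frac{b_r\, s_i(r)}{\sum_{j\in\mathcal{N}}s_j(r)}\right)$ (equal to $0$ if $s_i(r)=0$), and her total utility is $u_i({\sf s})=\sum_{r\in\mathcal{R}}u_{i,r}({\sf s})$. For $\delta>0$ the game is a $\delta$-share BAG if $s_i(r)\le\delta b_r$ for every player $i$, every $s_i\in\mathcal{S}_i$ and every resource $r$. $({\sf s}_{-i},s_i')$ denotes the profile obtained from ${\sf s}$ by replacing $i$'s strategy with $s_i'$. A pure Nash equilibrium is a profile ${\sf s}$ with $u_i({\sf s})\ge u_i({\sf s}_{-i},s_i')$ for all $i\in\mathcal{N}$ and all $s_i'\in\mathcal{S}_i$. *)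

(* Defs.v *)
From HB Require Import structures.
From mathcomp Require Import all_boot all_order all_algebra.
From mathcomp Require Import finmap.
From mathcomp Require Import reals.

Set Implicit Arguments.
Unset Strict Implicit.
Unset Printing Implicit Defensive.

Import Order.TTheory GRing.Theory Num.Theory.

Local Open Scope ring_scope.

(* A demand vector lists one demand per resource: [x 0 r] is the demand on r. *)
Record bag (R : realType) := Bag {
  players : nat;
  resources : nat;
  capacity : 'I_resources -> R;
  strategies : 'I_players -> {fset 'rV[R]_resources};
  capacity_gt0 : forall r, 0 < capacity r;
  strategies_neq0 : forall i, strategies i != fset0;
  strategies_ge0 : forall i x, x \in strategies i -> forall r, 0 <= x 0 r
}.

(* An arbitrary assignment of demand vectors to players; it is a strategy
   profile of G when it satisfies [is_profile]. *)
Definition assignment (R : realType) (G : bag R) : Type :=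
  'I_(players G) -> 'rV[R]_(resources G).

Definition is_profile (R : realType) (G : bag R) (s : assignment G) : Prop :=
  forall i, s i \in strategies i.

Definition resource_utility (R : realType) (G : bag R) (s : assignment G)
    (i : 'I_(players G)) (r : 'I_(resources G)) : R :=
  if s i 0 r == 0 then 0
  else Num.min (s i 0 r) (capacity r * s i 0 r / \sum_(j < players G) s j 0 r).

Definition utility (R : realType) (G : bag R) (s : assignment G)
    (i : 'I_(players G)) : R :=
  \sum_(r < resources G) resource_utility s i r.

Definition deviate (R : realType) (G : bag R) (s : assignment G)
    (i : 'I_(players G)) (x : 'rV[R]_(resources G)) : assignment G :=
  [eta s with i |-> x].

Definition pure_nash (R : realType) (G : bag R) (s : assignment G) : Prop :=
  is_profile s /\
  forall i x, x \in strategies i -> utility (deviate s i x) i <= utility s i.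

Definition delta_share (R : realType) (delta : R) (G : bag R) : Prop :=
  forall (i : 'I_(players G)) (x : 'rV[R]_(resources G)),
    x \in strategies i -> forall r, x 0 r <= delta * capacity r.

(* Main.v *)
(** Two players player_A and B play a game of matching pennies against a constant
    background load.  On a shared resource of capacity b and background load
    b - 2, let one player demand 2 and the other 1: each of them alone is served
    in full, but together they overload the resource by one unit and are
    both cut down by the factor b / (b + 1), so that the larger demand loses
    twice as much as the smaller one.  On the first resource A is the larger
    player, on the second one B is.  A either uses both shared resources or
    withdraws to an uncongested one; B chooses which of the two to use.  A
    prefers to be the smaller player in the conflict and B does too, and the
    uncongested payoffs are tuned so that best responses cycle.  The background
    load consists of b - 2 players with unit demand, hence all demands are at
    most 3 while b is arbitrarily large. *)
Require Import Defs.
From HB Require Import structures.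
From mathcomp Require Import all_boot all_order all_algebra.
From mathcomp Require Import finmap.
From mathcomp Require Import reals.
From mathcomp Require Import ring lra.

Set Implicit Arguments.
Unset Strict Implicit.
Unset Printing Implicit Defensive.

Import Order.TTheory GRing.Theory Num.Theory.

Local Open Scope ring_scope.

Lemma deviate_profile (R : realType) (G : bag R) (s : assignment G) i x :
  is_profile s -> x \in strategies i -> is_profile (deviate s i x).
Proof. by move=> sP xP j; rewrite /deviate /=; case: eqP => [->|_]. Qed.

Section Share.
Variables (R : realType) (b : R).

Definition share (x load : R) : R :=
  if x == 0 then 0 else Num.min x (b * x / load).

Lemma share0 load : share 0 load = 0.
Proof. by rewrite /share eqxx. Qed.

Lemma share_underload x load : 0 <= x -> 0 < load -> load <= b ->
  share x load = x.
Proof.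
move=> x_ge0 load_gt0 le_load_b; rewrite /share; case: eqP => [->//|_].
apply/min_idPl; rewrite ler_pdivlMr // mulrC; exact: ler_wpM2r.
Qed.

Lemma share_overload x load : 0 <= x -> 0 < load -> b <= load ->
  share x load = b * x / load.
Proof.
move=> x_ge0 load_gt0 le_b_load; rewrite /share.
case: eqP => [->|_]; first by rewrite mulr0 mul0r.
apply/min_idPr; rewrite ler_pdivrMr // mulrC; exact: ler_wpM2l.
Qed.

End Share.

Section Game.
Variables (R : realType) (n : nat).

Let b : R := n.+2%:R.

Definition demand (x y z : R) : 'rV[R]_3 := \row_r nth 0 [:: x; y; z] r.

(* Half of the relative loss [1 / (b + 1)] on an overloaded resource. *)
Definition half_loss : R := (2 * (b + 1))^-1.

Definition A_stay := demand 2 1 0.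
(** With h = [half_loss], the value 3 - 3h is midway between A's payoffs for staying: 3 - 4h against
    [B_fst] and 3 - 2h against [B_snd]. *)
Definition A_leave := demand 0 0 (3 - 3 * half_loss).
(** The private part 1 - h ranks [B_fst] below [B_snd] when A leaves (2 - h against 2) and above it
    when A stays (2 - 3h against 2 - 4h). *)
Definition B_fst := demand 1 0 (1 - half_loss).
Definition B_snd := demand 0 2 0.
Definition background := demand 1 1 0.

Definition pennies_strategies (i : 'I_n.+2) : {fset 'rV[R]_3} :=
  match val i with
  | 0%N => [fset A_stay; A_leave]%fset
  | 1%N => [fset B_fst; B_snd]%fset
  | _ => [fset background]%fset
  end.

Lemma half_loss_gt0 : 0 < half_loss.
Proof. by rewrite invr_gt0 mulr_gt0 // addr_gt0 // ltr0n. Qed.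

Lemma half_loss_lt1 : half_loss < 1.
Proof.
rewrite invf_lt1; last by rewrite mulr_gt0 // addr_gt0 // ltr0n.
by rewrite -natr1; have : 0 <= n.+1%:R :> R by []; lra.
Qed.

Lemma overload_factor : b / (b + 1) = 1 - 2 * half_loss.
Proof.
have b1_neq0 : b + 1 != 0 by rewrite gt_eqF // addr_gt0 // ltr0n.
by rewrite /half_loss; move: (b) b1_neq0 => c c1_neq0; field.
Qed.

Lemma pennies_strategies_bounds i x : x \in pennies_strategies i ->
  forall r, 0 <= x 0 r <= 3.
Proof.
have h0 := half_loss_gt0; have h1 := half_loss_lt1.
rewrite /pennies_strategies => x_i r; apply/andP.
case: (val i) x_i => [|[|k]]; rewrite ?in_fset2 ?in_fset1;
  [case/orP | case/orP |]; move=> /eqP ->; rewrite mxE;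
  by case: r => [[|[|[|r]]] ltr] //=; split; lra.
Qed.

Lemma pennies_strategies_neq0 i : pennies_strategies i != fset0.
Proof.
rewrite /pennies_strategies; apply/fset0Pn.
by case: (val i) => [|[|k]]; [exists A_stay | exists B_fst | exists background];
  rewrite ?in_fset2 ?in_fset1 eqxx.
Qed.

Definition pennies : bag R.
Proof.
refine (@Bag R n.+2 3 (fun=> b) pennies_strategies _ pennies_strategies_neq0 _).
- by move=> r; rewrite ltr0n.
- by move=> i x xi r; case/andP: (pennies_strategies_bounds xi r).
Defined.

Definition player_A : 'I_(players pennies) := ord0.
Definition player_B : 'I_(players pennies) := lift ord0 ord0.

(** Every player other than A and B has a single strategy, so loads depend on A and B alone. *)
Lemma pennies_load (s : assignment pennies) r : is_profile s ->
  \sum_j s j 0 r = s player_A 0 r + s player_B 0 r + n%:R * background 0 r.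
Proof.
move=> sP; rewrite 2!big_ord_recl addrA; congr (_ + _).
rewrite (eq_bigr (fun=> background 0 r)) => [|j _].
  by rewrite sumr_const card_ord mulr_natl.
by have := sP (lift ord0 (lift ord0 j)); rewrite in_fset1 => /eqP ->.
Qed.

Lemma pennies_utility (s : assignment pennies) i x y z x1 y1 z1 x2 y2 z2 :
    is_profile s -> s i = demand x y z ->
    s player_A = demand x1 y1 z1 -> s player_B = demand x2 y2 z2 ->
  utility s i = share b x (x1 + x2 + n%:R) + share b y (y1 + y2 + n%:R)
                + share b z (z1 + z2).
Proof.
move=> sP si sA sB; rewrite /utility /resource_utility.
under eq_bigr => r _ do rewrite pennies_load // si sA sB.
by rewrite !big_ord_recl big_ord0 !mxE /= mulr1 mulr0 !addr0 addrA.
Qed.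

(** Here [load] is the joint demand of A and B; the background leaves them b - n = 2 units. *)
Lemma share_fits x load : 0 <= x <= load -> load <= 2 ->
  share b x (load + n%:R) = x.
Proof.
case/andP=> x_ge0 le_x le_load2; have [->|x_neq0] := eqVneq x 0.
  exact: share0.
have x_gt0 : 0 < x by rewrite lt_neqAle eq_sym x_neq0.
rewrite share_underload //; first by rewrite ltr_wpDr // (lt_le_trans x_gt0).
by rewrite /b -add2n natrD lerD2r.
Qed.

(** The load is b + 1 in both cases. The order 2 + 1 occurs on the first resource and 1 + 2 on the
    second, A's demand coming first. *)
Lemma share_conflict x : 0 <= x ->
  (share b x (2 + 1 + n%:R) = x * (1 - 2 * half_loss))
  * (share b x (1 + 2 + n%:R) = x * (1 - 2 * half_loss)).
Proof.
move=> x_ge0; rewrite [1 + 2]addrC.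
have -> : 2 + 1 + n%:R = b + 1 by rewrite /b -[n.+2]add2n natrD; ring.
rewrite share_overload // ?addr_gt0 ?ltr0n // ?lerDl //.
by rewrite -overload_factor mulrAC mulrC.
Qed.

(** For the third resource, where A and B together demand at most 4 - 4h; [2 <= n] ensures b >=
    4. *)
Lemma share_private x load : (2 <= n)%N -> 0 <= x <= load -> load <= 4 ->
  share b x load = x.
Proof.
move=> n_ge2 /andP[x_ge0 le_x] le_load4; have [->|x_neq0] := eqVneq x 0.
  exact: share0.
rewrite share_underload //.
  by rewrite (lt_le_trans _ le_x) // lt_neqAle eq_sym x_neq0.
by rewrite (le_trans le_load4) // ler_nat.
Qed.

Lemma payoffs_stay_fst (s : assignment pennies) :
    (2 <= n)%N -> is_profile s -> s player_A = A_stay -> s player_B = B_fst ->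
  utility s player_A = 3 - 4 * half_loss /\ utility s player_B = 2 - 3 * half_loss.
Proof.
move=> n_ge2 sP sA sB.
rewrite (pennies_utility sP sA sA sB) (pennies_utility sP sB sA sB).
have h_gt0 := half_loss_gt0; have h_lt1 := half_loss_lt1.
rewrite !share_conflict // !share_fits ?share_private //; by [lra | split; lra].
Qed.

Lemma payoffs_stay_snd (s : assignment pennies) :
    (2 <= n)%N -> is_profile s -> s player_A = A_stay -> s player_B = B_snd ->
  utility s player_A = 3 - 2 * half_loss /\ utility s player_B = 2 - 4 * half_loss.
Proof.
move=> n_ge2 sP sA sB.
rewrite (pennies_utility sP sA sA sB) (pennies_utility sP sB sA sB).
have h_gt0 := half_loss_gt0; have h_lt1 := half_loss_lt1.
rewrite !share_conflict // !share_fits ?share_private //; by [lra | split; lra].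
Qed.

Lemma payoffs_leave_fst (s : assignment pennies) :
    (2 <= n)%N -> is_profile s -> s player_A = A_leave -> s player_B = B_fst ->
  utility s player_A = 3 - 3 * half_loss /\ utility s player_B = 2 - half_loss.
Proof.
move=> n_ge2 sP sA sB.
rewrite (pennies_utility sP sA sA sB) (pennies_utility sP sB sA sB).
have h_gt0 := half_loss_gt0; have h_lt1 := half_loss_lt1.
rewrite !share_fits ?share_private //; by [lra | split; lra].
Qed.

Lemma payoffs_leave_snd (s : assignment pennies) :
    (2 <= n)%N -> is_profile s -> s player_A = A_leave -> s player_B = B_snd ->
  utility s player_A = 3 - 3 * half_loss /\ utility s player_B = 2.
Proof.
move=> n_ge2 sP sA sB.
rewrite (pennies_utility sP sA sA sB) (pennies_utility sP sB sA sB).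
have h_gt0 := half_loss_gt0; have h_lt1 := half_loss_lt1.
rewrite !share_fits ?share_private //; by [lra | split; lra].
Qed.

(** Improving moves form a cycle through all four profiles: from (stay, fst) A leaves, then B turns
    to snd, A returns, and B goes back to fst. *)
Lemma pennies_no_nash (s : assignment pennies) : (2 <= n)%N -> ~ pure_nash s.
Proof.
move=> n_ge2 [sP nash]; have h_gt0 := half_loss_gt0.
have devA x y : s player_B = y -> x \in strategies player_A ->
    exists t : assignment pennies,
      [/\ is_profile t, t player_A = x, t player_B = y
        & utility t player_A <= utility s player_A].
  move=> sB xA; exists (deviate s player_A x).
  by split=> //; [exact: deviate_profile | exact: nash].
have devB x y : s player_A = x -> y \in strategies player_B ->
    exists t : assignment pennies,
      [/\ is_profile t, t player_A = x, t player_B = y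
        & utility t player_B <= utility s player_B].
  move=> sA yB; exists (deviate s player_B y).
  by split=> //; [exact: deviate_profile | exact: nash].
have := sP player_A; have := sP player_B.
rewrite !in_fset2 => /orP[] /eqP sB /orP[] /eqP sA.
- have [|t [tP tA tB]] := devA A_leave _ sB; first by rewrite in_fset2 eqxx orbT.
  rewrite (payoffs_stay_fst n_ge2 sP sA sB).1.
  by rewrite (payoffs_leave_fst n_ge2 tP tA tB).1; lra.
- have [|t [tP tA tB]] := devB _ B_snd sA; first by rewrite in_fset2 eqxx orbT.
  rewrite (payoffs_leave_fst n_ge2 sP sA sB).2.
  by rewrite (payoffs_leave_snd n_ge2 tP tA tB).2; lra.
- have [|t [tP tA tB]] := devB _ B_fst sA; first by rewrite in_fset2 eqxx.
  rewrite (payoffs_stay_snd n_ge2 sP sA sB).2.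
  by rewrite (payoffs_stay_fst n_ge2 tP tA tB).2; lra.
- have [|t [tP tA tB]] := devA A_stay _ sB; first by rewrite in_fset2 eqxx.
  rewrite (payoffs_leave_snd n_ge2 sP sA sB).1.
  by rewrite (payoffs_stay_snd n_ge2 tP tA tB).1; lra.
Qed.

End Game.

Theorem corollary3p2 (R : realType) (delta : R) (delta_gt0 : 0 < delta) :
  exists G : bag R,
    delta_share delta G /\ ~ (exists s : assignment G, pure_nash s).
Proof.
(* Demands are at most 3, so b >= 3 / delta suffices; the added 2 gives [2 <= n]. *)
pose n := (Num.bound (3 / delta)).+2.
exists (pennies R n); split=> [i x xi r|[s]]; last exact: pennies_no_nash.
have /andP[_ /le_trans] := pennies_strategies_bounds xi r; apply.
rewrite mulrC -ler_pdivrMr //; apply: ltW.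
apply: lt_le_trans (archi_boundP _) _; first by rewrite divr_ge0 // ltW.
by rewrite ler_nat /n -addn4 leq_addr.
Qed.
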